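(* Let $\Omega\subset\mathbb H$ be a bounded domain and let $f:\Omega\to\mathbb H$ be a function of class $C^1(\overline\Omega)$. Let $A=(a_{\alpha\beta})_{\alpha,\beta=1,2,3}$ be the $3\times 3$ matrix with entries \[a_{\alpha\beta}=-\int_\Omega \langle J_\alpha,f^*L_{i_\beta}\rangle\, dV .\] Then: \begin{enumerate} \item $f$ is $\psi$-regular on $\Omega$ if and only if $\mathcal E(f)=\operatorname{tr} A$. \item If $f$ is $\psi$-regular on $\Omega$, then $A$ is real and symmetric and $\operatorname{tr}A\ge\lambda_1$, where $\lambda_1$ is the largest eigenvalue of $A$. It follows that $\det(A-(\operatorname{tr}A)I_3)\le 0$. \item If $f$ is $\psi$-regular on $\Omega$, then $f$ belongs to $Hol_p(\Omega,\mathbb H)$ for some $p\in\mathbb S^2$ if and only if $\mathcal E(f)=\operatorname{tr}A=\lambda_1$ or, equivalently, if and only if $\det(A-(\operatorname{tr}A)I_3)=0$. \item If $\mathcal E(f)=\operatorname{tr}A=\lambda_1$, then for $p=p_1i+p_2j+p_3k\in\mathbb S^2$ the unit vector $X_p=(p_1,p_2,p_3)$ is an eigenvector of $A$ relative to the largest eigenvalue $\lambda_1$ if and only if $f\in Hol_p(\Omega,\mathbb H)$. \end{enumerate}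
   Context: Identify $\mathbb H\simeq\mathbb R^4\simeq\mathbb C^2$ via $q=x_0+ix_1+jx_2+kx_3=z_1+z_2j$, with $z_1=x_0+ix_1$, $z_2=x_2+ix_3$, and equip it with the Euclidean metric; $dV$ is the Euclidean volume element. $\mathbb S^2=\{p\in\mathbb H: p^2=-1\}$ is the sphere of unit imaginary quaternions $p=p_1i+p_2j+p_3k$. $C^1(\overline\Omega)$ denotes $C^1$ functions on $\Omega$ that extend continuously, together with their first partial derivatives, to $\overline\Omega$. A function $f\in C^1(\Omega,\mathbb H)$ is (left) $\psi$-regular on $\Omega$ if \[\frac{\partial f}{\partial x_0}+i\frac{\partial f}{\partial x_1}+j\frac{\partial f}{\partial x_2}-k\frac{\partial f}{\partial x_3}=0\quad\text{on }\Omega.\] Complex structures on the source: on each tangent space $T_x\mathbb H\simeq\mathbb H$, $J_1$ and $J_2$ are left multiplication by $i$ and $j$, and $J_3=-J_1J_2$ (so $J_3$ is left multiplication by $-k$). For $p\in\mathbb S^2$ put $J_p=p_1J_1+p_2J_2+p_3J_3$. Complex structures on the target: $L_p$ is left multiplication by $p$ on $\mathbb H$; put $i_1=i$, $i_2=j$, $i_3=k$. $Hol_p(\Omega,\mathbb H)$ is the set of ($C^1$) maps $f:\Omega\to\mathbb H$ that are holomorphic from $(\Omega,J_p)$ to $(\mathbb H,L_p)$, i.e. such that $df+L_p\circ df\circ J_p=0$ on $\Omega$ (equivalently $df\circ J_p=L_p\circ df$). The energy of $f\in C^1(\overline\Omega)$ is $\mathcal E(f)=\frac12\int_\Omega\|df\|^2\,dV$,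 where $\|\cdot\|$ is the Euclidean (Hilbert–Schmidt) norm of the real linear map $df_x:\mathbb R^4\to\mathbb R^4$. The integrand in $a_{\alpha\beta}$ is the pointwise quantity \[\langle J_\alpha,f^*L_{i_\beta}\rangle=\tfrac12\,\langle df,\;L_{i_\beta}\circ df\circ J_\alpha\rangle,\] where on the right $\langle S,T\rangle=\operatorname{tr}(S^{T}T)$ is the Hilbert–Schmidt inner product of real linear maps $\mathbb R^4\to\mathbb R^4$. Equivalently, $a_{\alpha\beta}=\frac12\int_\Omega\langle df\circ J_\alpha,\,L_{i_\beta}\circ df\rangle\,dV$. *)

(* Defs.v *)
From HB Require Import structures.
From mathcomp Require Import all_boot all_order all_algebra.
From mathcomp Require Import all_classical all_reals all_analysis.
Set Implicit Arguments.
Unset Strict Implicit.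
Unset Printing Implicit Defensive.
Import Order.TTheory GRing.Theory Num.Theory.
Import numFieldNormedType.Exports.

Local Open Scope classical_set_scope.
Local Open Scope ring_scope.

(* The quaternion x0 + i x1 + j x2 + k x3 is the row vector (x0, x1, x2, x3).
   The norm of 'rV_4 is the sup norm; it only serves for topological notions
   (open, bounded, continuous, differentiable).  Euclidean quantities go
   through [hs_inner] below. *)
Notation quaternion R := 'rV[R]_4.

Definition quat (R : realType) (a b c d : R) : quaternion R :=
  \row_(i < 4) nth 0 [:: a; b; c; d] i.

Definition qone (R : realType) : quaternion R := quat 1 0 0 0.
Definition qi (R : realType) : quaternion R := quat 0 1 0 0.
Definition qj (R : realType) : quaternion R := quat 0 0 1 0.
Definition qk (R : realType) : quaternion R := quat 0 0 0 1.

Definition re (R : realType) (x : quaternion R) : R := x 0 ord0.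
Definition im (R : realType) (x : quaternion R) (a : 'I_3) : R :=
  x 0 (lift ord0 a).

Definition qmul (R : realType) (x y : quaternion R) : quaternion R :=
  let x0 := re x in let x1 := im x 0 in
  let x2 := im x 1 in let x3 := im x 2%:R in
  let y0 := re y in let y1 := im y 0 in
  let y2 := im y 1 in let y3 := im y 2%:R in
  quat (x0 * y0 - x1 * y1 - x2 * y2 - x3 * y3)
       (x0 * y1 + x1 * y0 + x2 * y3 - x3 * y2)
       (x0 * y2 - x1 * y3 + x2 * y0 + x3 * y1)
       (x0 * y3 + x1 * y2 - x2 * y1 + x3 * y0).

Definition sphere2 (R : realType) : set (quaternion R) :=
  [set p | qmul p p = - qone R].

Definition imvec (R : realType) (p : quaternion R) : 'cV[R]_3 :=
  \col_(a < 3) im p a.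

(* Indices 1, 2, 3 are represented by 0, 1, 2 : 'I_3. *)
Definition iunit (R : realType) (b : 'I_3) : quaternion R :=
  tnth [tuple qi R; qj R; qk R] b.

Definition Lmul (R : realType) (p v : quaternion R) : quaternion R := qmul p v.

Definition J1 (R : realType) (v : quaternion R) : quaternion R := qmul (qi R) v.
Definition J2 (R : realType) (v : quaternion R) : quaternion R := qmul (qj R) v.
Definition J3 (R : realType) (v : quaternion R) : quaternion R := - J1 (J2 v).

Definition Jbase (R : realType) (a : 'I_3) : quaternion R -> quaternion R :=
  tnth [tuple @J1 R; @J2 R; @J3 R] a.

Definition Jstruct (R : realType) (p v : quaternion R) : quaternion R :=
  \sum_(a < 3) im p a *: Jbase a v.

Section FunctionSpaces.
Variable R : realType.
Implicit Types (Omega : set (quaternion R)) (f : quaternion R -> quaternion R).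

Definition partial (i : 'I_4) f (x : quaternion R) : quaternion R :=
  'D_(delta_mx 0 i) f x.

(* Maps on Omega are total functions whose values outside Omega are
   irrelevant: all uses below are for open Omega. *)
Definition C1 Omega f : Prop :=
  (forall x, Omega x -> differentiable f x) /\
  (forall i, {within Omega, continuous (partial i f)}).

Definition extends_to_closure Omega f : Prop :=
  exists2 g : quaternion R -> quaternion R,
    {within closure Omega, continuous g} & forall x, Omega x -> g x = f x.

Definition C1_closure Omega f : Prop :=
  [/\ C1 Omega f, extends_to_closure Omega f &
      forall i, extends_to_closure Omega (partial i f)].

Definition psi_regular Omega f : Prop :=
  C1 Omega f /\
  forall x, Omega x ->
    partial 0 f x + qmul (qi R) (partial 1 f x)
      + qmul (qj R) (partial 2%:R f x) - qmul (qk R) (partial 3%:R f x) = 0.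

Definition Hol (p : quaternion R) Omega f : Prop :=
  C1 Omega f /\
  forall x, Omega x ->
    forall v, 'd f x v + Lmul p ('d f x (Jstruct p v)) = 0.

End FunctionSpaces.

(* The matrix of a linear map acting on column vectors; [lin1_mx] is its
   transpose. *)
Definition colmx (R : realType) (S : quaternion R -> quaternion R) : 'M[R]_4 :=
  (lin1_mx S)^T.

Definition hs_inner (R : realType) (S T : quaternion R -> quaternion R) : R :=
  \tr ((colmx S)^T *m colmx T).

(* Lebesgue measure on R^4 is the iterated product of the one on R, which lives
   on nested pairs; [of_pairs] transports it to row vectors. *)
Definition of_pairs (R : realType) (u : R * R * R * R) : quaternion R :=
  quat u.1.1.1 u.1.1.2 u.1.2 u.2.

Section Integrals.
Variable R : realType.
Local Notation mu := (@lebesgue_measure R).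

Definition vol_integral (Omega : set (quaternion R)) (g : quaternion R -> R) : R :=
  \int[(mu \x mu \x mu \x mu)%E]_(u in @of_pairs R @^-1` Omega) g (of_pairs u).

Definition energy (Omega : set (quaternion R)) (f : quaternion R -> quaternion R)
    : R :=
  2^-1 * vol_integral Omega (fun x => hs_inner ('d f x) ('d f x)).

Definition pullback_inner (a b : 'I_3) (f : quaternion R -> quaternion R)
    (x : quaternion R) : R :=
  2^-1 * hs_inner ('d f x) (Lmul (iunit R b) \o 'd f x \o @Jbase R a).

Definition energy_mx (Omega : set (quaternion R))
    (f : quaternion R -> quaternion R) : 'M[R]_3 :=
  \matrix_(a < 3, b < 3) - vol_integral Omega (pullback_inner a b f).

End Integrals.

(* [eigenvalue] is defined with row eigenvectors, which does not affect the
   spectrum of a square matrix. *)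
Definition largest_eigenvalue (R : realType) (n : nat) (A : 'M[R]_n) (l : R) : Prop :=
  eigenvalue A l /\ forall m, eigenvalue A m -> m <= l.

Definition eigenvector (R : realType) (n : nat) (A : 'M[R]_n) (l : R)
    (v : 'cV[R]_n) : Prop :=
  v != 0 /\ A *m v = l *: v.

(* Main.v *)
(** Let D be the Jacobian matrix of f at a point.  The maps
    Q_p : D |-> L_p o D o J_p are orthogonal involutions, and Q_1, Q_2, Q_3
    (for p = i, j, k) commute with Q_1 Q_2 = Q_3.  Hence, pointwise,
      |D|^2 + sum_a <D, Q_a D> = |psi(D)|^2   and
      |D|^2 + <D, Q_p D> = 1/2 |D + Q_p D|^2,
    where psi(D) = 0 is the equation of psi-regularity and D + Q_p D = 0 that
    of Hol_p.  Integrating, energy f - tr A = 1/2 int |psi(D)|^2 and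
    energy f - X_p^T A X_p = 1/4 int |D + Q_p D|^2.  A continuous nonnegative
    function on an open set with zero integral vanishes, so f is psi-regular
    iff energy f = tr A, and f is in Hol_p iff X_p^T A X_p = energy f.
    Moreover energy f - A is positive semidefinite, and psi(D) = 0 makes A
    symmetric, so that the null vectors of the quadratic form of energy f - A
    are the eigenvectors of A for the eigenvalue energy f. *)
Require Import Defs.
From HB Require Import structures.
From mathcomp Require Import all_boot all_order all_algebra.
From mathcomp Require Import all_classical all_reals all_analysis.
From mathcomp Require polyrcf.
From mathcomp Require Import ring lra.
Set Implicit Arguments.
Unset Strict Implicit.
Unset Printing Implicit Defensive.
Import Order.TTheory GRing.Theory Num.Theory.
Import numFieldNormedType.Exports.
Local Open Scope classical_set_scope.
Local Open Scope ring_scope.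

(** * Open boxes and measurability of open sets in four dimensions *)

(** Boxes link the two descriptions of four-space: they are basic for the sup-norm topology on row
    vectors, and their preimages under [of_pairs] are measurable rectangles of known volume. *)
Definition box (R : realType) (a b : 'I_4 -> R) : set (quaternion R) :=
  [set x | forall i, x 0 i \in `]a i, b i[].

Local Notation vol4 R :=
  (@lebesgue_measure R \x @lebesgue_measure R \x @lebesgue_measure R
    \x @lebesgue_measure R)%E.

Lemma forall_ord4 (P : 'I_4 -> Prop) :
  (forall i, P i) <-> [/\ P 0, P 1, P 2%:R & P 3%:R].
Proof.
split=> [PH|[P0 P1 P2 P3] i]; first by split; exact: PH.
by case: i => [[|[|[|[|//]]]] Hi]; [have := P0 | have := P1 | have := P2 | have := P3];
  congr P; apply: val_inj.
Qed.

Lemma preimage_box (R : realType) (a b : 'I_4 -> R) :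
  @of_pairs R @^-1` box a b =
  (`]a 0, b 0[ `*` `]a 1, b 1[ `*` `]a 2%:R, b 2%:R[ `*` `]a 3%:R, b 3%:R[)%classic.
Proof.
apply/seteqP; split=> -[[[u0 u1] u2] u3];
  rewrite /box /preimage /= /of_pairs /quat forall_ord4 !mxE /=.
  by case.
by move=> [[[]]].
Qed.

Lemma measurable_box (R : realType) (a b : 'I_4 -> R) :
  measurable (@of_pairs R @^-1` box a b).
Proof.
by rewrite preimage_box; do 3 (apply: measurableX; last exact: measurable_itv);
  exact: measurable_itv.
Qed.

Lemma vol4_rect (R : realType) (A B C D : set (measurableTypeR R)) :
  measurable A -> measurable B -> measurable C -> measurable D ->
  (vol4 R (A `*` B `*` C `*` D) = lebesgue_measure A * lebesgue_measure B *
    lebesgue_measure C * lebesgue_measure D)%E.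
Proof.
move=> mA mB mC mD; rewrite product_measure1E //; last first.
  by do 2 apply: measurableX => //.
congr (_ * _)%E; rewrite /= product_measure1E //; last exact: measurableX.
by congr (_ * _)%E; rewrite /= product_measure1E.
Qed.

Lemma vol4_box (R : realType) (a b : 'I_4 -> R) : (forall i, a i < b i) ->
  vol4 R (@of_pairs R @^-1` box a b) = (\prod_i (b i - a i))%:E.
Proof.
move=> ab; rewrite preimage_box.
rewrite [LHS](@vol4_rect R) //; try exact: measurable_itv.
rewrite !lebesgue_measure_itv /= !lte_fin !ab -!EFinD -!EFinM.
rewrite !big_ord_recr big_ord0 /= mul1r.
by congr (_ * _ * _ * _)%:E; congr (b _ - a _); apply: val_inj.
Qed.

(** A sup-norm ball is a cube, and each of its half-edges contains a rational. Rational endpoints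
    leave only countably many boxes, which gives measurability of open sets; the box itself later
    serves as a neighbourhood of positive volume. *)
Lemma open_rat_box (R : realType) (O : set (quaternion R)) (x : quaternion R) :
  open O -> O x -> exists c : {ffun 'I_4 -> rat * rat},
    let B := box (fun i => ratr (c i).1) (fun i => ratr (c i).2) in
    B x /\ B `<=` O.
Proof.
rewrite openE => oO /oO /nbhs_ballP[e /= e0 ballO].
have rat_lo i : {q : rat | ratr q \in `]x 0 i - e, x 0 i[}.
  by apply/cid/rat_in_itvoo; rewrite ltrBlDr ltrDl.
have rat_hi i : {q : rat | ratr q \in `]x 0 i, x 0 i + e[}.
  by apply/cid/rat_in_itvoo; rewrite ltrDl.
exists [ffun i => (sval (rat_lo i), sval (rat_hi i))]; split=> [i|y By].
  rewrite ffunE in_itv /=.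
  case: (rat_lo i) (rat_hi i) => q /=; rewrite in_itv /= => /andP[_ ->] [r /=].
  by rewrite in_itv /= => /andP[-> _].
apply: ballO; split=> // j i; rewrite (ord1 j) /ball /= ltr_distlC.
have := By i; rewrite ffunE in_itv /=.
case: (rat_lo i) (rat_hi i) => q /=; rewrite in_itv /= => /andP[xq _] [r /=].
rewrite in_itv /= => /andP[_ rx] /andP[qy yr].
by rewrite (lt_trans xq qy) (lt_trans yr rx).
Qed.

Lemma open_measurable_of_pairs (R : realType) (O : set (quaternion R)) :
  open O -> measurable (@of_pairs R @^-1` O).
Proof.
move=> oO.
pose B (c : {ffun 'I_4 -> rat * rat}) : set (quaternion R) :=
  box (fun i => ratr (c i).1) (fun i => ratr (c i).2).
(* Boxes that leave [O] are replaced by the empty set, so that the union runs over the whole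
   countable type of rational endpoints. *)
pose F c := if `[< B c `<=` O >] then @of_pairs R @^-1` B c else set0.
rewrite (_ : _ @^-1` _ = \bigcup_c F c); last first.
  apply/seteqP; split=> [u /= Ou|u [c _]]; last by rewrite /F; case: asboolP => // BO /BO.
  have [c [Bu BO]] := open_rat_box oO Ou.
  by exists c => //; rewrite /F; case: asboolP.
apply: countable_bigcupT_measurable => [|c]; first exact: countableP.
by rewrite /F; case: asboolP => _; [exact: measurable_box|exact: measurable0].
Qed.

(** * Integration of bounded continuous functions over a bounded open set *)

(** The class of all integrands below: it is stable under sums and products, and its members are
    integrable over a bounded open set. Continuity is meant in the ambient space at each point of
    [Omega]. *)
Definition bounded_continuous (R : realType) (Omega : set (quaternion R))
    (g : quaternion R -> R) : Prop :=
  {in Omega, continuous g} /\ exists M, forall x, Omega x -> `|g x| <= M.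

Section BoundedContinuous.
Variables (R : realType) (Omega : set (quaternion R)).
Implicit Types g h : quaternion R -> R.

Lemma bounded_continuous_cst c : bounded_continuous Omega (fun=> c).
Proof.
split=> [x _|]; first exact: cst_continuous.
by exists `|c| => x _; rewrite lexx.
Qed.

Lemma bounded_continuousD g h : bounded_continuous Omega g ->
  bounded_continuous Omega h -> bounded_continuous Omega (fun x => g x + h x).
Proof.
move=> [cg bg] [ch bh]; split=> [x xO|]; first exact: cvgD (cg x xO) (ch x xO).
move: bg bh => [M gM] [N hN].
by exists (M + N) => x xO; rewrite (le_trans (ler_normD _ _))// lerD ?gM ?hN.
Qed.

Lemma bounded_continuousM g h : bounded_continuous Omega g ->
  bounded_continuous Omega h -> bounded_continuous Omega (fun x => g x * h x).
Proof.
move=> [cg bg] [ch bh]; split=> [x xO|]; first exact: cvgM (cg x xO) (ch x xO).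
move: bg bh => [M gM] [N hN].
by exists (M * N) => x xO; rewrite normrM ler_pM ?gM ?hN.
Qed.

Lemma bounded_continuous_sum (I : Type) (r : seq I) (P : pred I)
    (F : I -> quaternion R -> R) : (forall i, bounded_continuous Omega (F i)) ->
  bounded_continuous Omega (fun x => \sum_(i <- r | P i) F i x).
Proof.
move=> bF; elim: r => [|i r IHr].
  by under eq_fun do rewrite big_nil; exact: bounded_continuous_cst.
under eq_fun do rewrite big_cons.
by case: (P i) => //; exact: bounded_continuousD.
Qed.

Hypotheses (oO : open Omega) (bO : bounded_set Omega).

Lemma bounded_set_finite_volume : (vol4 R (@of_pairs R @^-1` Omega) < +oo)%E.
Proof.
have [M Mgt0 OM] : exists2 M, 0 < M & forall x, Omega x -> `|x| <= M.
  case: bO => M0 [_ OM0]; exists (`|M0| + 1); first by rewrite ltr_wpDl.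
  by apply: OM0; rewrite (le_lt_trans (ler_norm _))// ltrDl.
(* The extra 1 makes the bound strict, as an open box requires. *)
pose N := M + 1.
have OB : @of_pairs R @^-1` Omega `<=` @of_pairs R @^-1` box (fun=> - N) (fun=> N).
  move=> u /OM uM i; rewrite in_itv /= -ltr_norml (le_lt_trans _ (ltr_pwDr ltr01 uM)) //.
  rewrite [leRHS]mx_normrE; exact: (le_bigmax _ (fun ij => `|of_pairs u ij.1 ij.2|) (0, i)).
apply: (@le_lt_trans _ _ (vol4 R (@of_pairs R @^-1` box (fun=> - N) (fun=> N)))).
  rewrite le_measure ?inE //; first exact: open_measurable_of_pairs.
  exact: measurable_box.
by rewrite vol4_box ?ltry // => i; rewrite gtrN // /N ltr_wpDr.
Qed.

(** Open intervals generate the Borel sets of the line, and their preimages within the open set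
    [Omega] are open. *)
Lemma bounded_continuous_measurable g : bounded_continuous Omega g ->
  measurable_fun (@of_pairs R @^-1` Omega) (g \o @of_pairs R).
Proof.
move=> [cg _]; apply: (measurability _ (measurable_realfun.RGenOpens.measurableE R)).
move=> _ [_ [a [b ->] <-]].
rewrite (_ : _ `&` _ = @of_pairs R @^-1` (Omega `&` g @^-1` `]a, b[)) //.
apply: open_measurable_of_pairs.
by move/(continuous_inP _ oO): cg; apply; exact: interval_open.
Qed.

Lemma bounded_continuous_integrable g : bounded_continuous Omega g ->
  (vol4 R).-integrable (@of_pairs R @^-1` Omega) (EFin \o (g \o @of_pairs R)).
Proof.
move=> bg; apply: measurable_bounded_integrable.
- exact: open_measurable_of_pairs.
- exact: bounded_set_finite_volume.
- exact: bounded_continuous_measurable.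
case: bg => _ [M gM].
exists M; split=> [|y /ltW My u /gM guM]; first exact: num_real.
exact: le_trans guM My.
Qed.

Lemma vol_integralD g h : bounded_continuous Omega g -> bounded_continuous Omega h ->
  vol_integral Omega (fun x => g x + h x) = vol_integral Omega g + vol_integral Omega h.
Proof.
move=> bg bh; apply: RintegralD; first exact: open_measurable_of_pairs.
  exact: (bounded_continuous_integrable bg).
exact: (bounded_continuous_integrable bh).
Qed.

Lemma vol_integralZ c g : bounded_continuous Omega g ->
  vol_integral Omega (fun x => c * g x) = c * vol_integral Omega g.
Proof.
move=> bg; apply: RintegralZl; first exact: open_measurable_of_pairs.
exact: (bounded_continuous_integrable bg).
Qed.

Lemma vol_integral0 : vol_integral Omega (fun=> 0) = 0.
Proof.
have /(vol_integralZ 0) := bounded_continuous_cst 0.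
by under eq_fun do rewrite mul0r; rewrite mul0r.
Qed.

Lemma vol_integral_sum (I : Type) (r : seq I) (F : I -> quaternion R -> R) :
  (forall i, bounded_continuous Omega (F i)) ->
  vol_integral Omega (fun x => \sum_(i <- r) F i x) =
  \sum_(i <- r) vol_integral Omega (F i).
Proof.
move=> bF; elim: r => [|i r IHr].
  by under eq_fun do rewrite big_nil; rewrite big_nil vol_integral0.
under eq_fun do rewrite big_cons; rewrite big_cons -IHr vol_integralD //.
exact: bounded_continuous_sum.
Qed.

Lemma eq_vol_integral g h : (forall x, Omega x -> g x = h x) ->
  vol_integral Omega g = vol_integral Omega h.
Proof. by move=> gh; apply: eq_Rintegral => u; rewrite inE => /gh. Qed.

Lemma vol_integral_ge0 g : (forall x, Omega x -> 0 <= g x) -> 0 <= vol_integral Omega g.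
Proof. by move=> g0; apply: Rintegral_ge0 => u /g0. Qed.

(** If g(x) > 0, then g exceeds g(x)/2 on a box around x inside [Omega]; the box has positive
    volume, so the integral would be positive. *)
Lemma vol_integral_eq0 g : bounded_continuous Omega g ->
  (forall x, Omega x -> 0 <= g x) -> vol_integral Omega g = 0 ->
  forall x, Omega x -> g x = 0.
Proof.
move=> bg g0 intg0 x Ox; apply/eqP; rewrite eq_le g0 // andbT leNgt; apply/negP => gx.
have oW : open (Omega `&` g @^-1` [set y | g x / 2 < y]).
  by case: bg => cg _; move/(continuous_inP _ oO): cg; apply; exact: open_gt.
have [|c [Bx BW]] := @open_rat_box _ _ x oW.
  by split=> //=; rewrite ltr_pdivrMr // mulrDr mulr1 ltrDl.
move: Bx BW; set B := box _ _ => Bx BW.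
have mO := open_measurable_of_pairs oO.
have mB : measurable (@of_pairs R @^-1` B) by exact: measurable_box.
have BO : @of_pairs R @^-1` B `<=` @of_pairs R @^-1` Omega by move=> u /BW[].
have volB : (0 < vol4 R (@of_pairs R @^-1` B))%E.
  rewrite vol4_box; last by move=> i; have := Bx i; rewrite in_itv => /andP[]; exact: lt_trans.
  rewrite lte_fin prodr_gt0 // => i _; rewrite subr_gt0.
  by have := Bx i; rewrite in_itv => /andP[]; exact: lt_trans.
have ig := bounded_continuous_integrable bg.
(* The real-valued integral is the finite part of the extended one, so integrability is what turns
   its vanishing into that of the extended integral. *)
have ig0 : (\int[vol4 R]_(u in @of_pairs R @^-1` Omega) (g (of_pairs u))%:E = 0)%E.
  by rewrite -[LHS]fineK ?(congr1 EFin intg0)//; exact: integrable_fin_num.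
have mg := measurable_int _ ig.
have gB : (\int[vol4 R]_(u in @of_pairs R @^-1` B) (g x / 2)%:E
    <= \int[vol4 R]_(u in @of_pairs R @^-1` B) (g (of_pairs u))%:E)%E.
  apply: ge0_le_integral => //.
  - by move=> u _; rewrite lee_fin divr_ge0 // ltW.
  - exact: (measurable_funS mO BO mg).
  - by move=> u /BW[_ /= /ltW]; rewrite lee_fin.
have BleO : (\int[vol4 R]_(u in @of_pairs R @^-1` B) (g (of_pairs u))%:E
    <= \int[vol4 R]_(u in @of_pairs R @^-1` Omega) (g (of_pairs u))%:E)%E.
  by apply: ge0_subset_integral => // u /g0; rewrite lee_fin.
have := le_trans gB BleO.
rewrite ig0 integral_cst // leNgt mule_gt0 // lte_fin divr_gt0 //.
Qed.

End BoundedContinuous.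

(** * Real roots of characteristic polynomials *)

Lemma horner_char_poly (R : comNzRingType) (n : nat) (A : 'M[R]_n) (t : R) :
  (char_poly A).[t] = \det (t%:M - A).
Proof.
rewrite -horner_evalE -det_map_mx; congr (\det _).
apply/matrixP => i j; rewrite !mxE /= horner_evalE hornerD hornerN hornerC hornerMn hornerX.
by case: eqP.
Qed.

Lemma monic_pinfty_ge1 (R : realFieldType) (p : {poly R}) : p \is monic ->
  exists N, forall x, x >= N -> 1 <= p.[x].
Proof.
move=> /monicP p1; have [|N pN] := @polyrcf.poly_pinfty_gt_lc _ p; first by rewrite p1.
by exists N => x /pN; rewrite p1.
Qed.

(** The determinant is the characteristic polynomial at t. Being monic, this polynomial is positive
    far to the right, so a negative value at t would force a root at or beyond t. The bound on
    eigenvalues makes that root t itself, a contradiction. *)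
Lemma eigenvalue_le_det_ge0 (R : rcfType) (n : nat) (A : 'M[R]_n) (t : R) :
  (forall l, eigenvalue A l -> l <= t) -> 0 <= \det (t%:M - A).
Proof.
move=> At; rewrite -horner_char_poly leNgt; apply/negP => pt.
have [N pN] := monic_pinfty_ge1 (char_poly_monic A).
have tx : t <= Num.max t N by rewrite le_max lexx.
have px : 1 <= (char_poly A).[Num.max t N] by apply: pN; rewrite le_max lexx orbT.
have [|l] := @polyrcf.poly_ivt _ (char_poly A) _ _ tx.
  by rewrite nmulr_rle0 // (le_trans ler01).
rewrite in_itv /= => /andP[tl _] rl.
have lt : l = t by apply/le_anti; rewrite tl At // eigenvalue_root_char.
by move: rl pt; rewrite lt => /rootP ->; rewrite ltxx.
Qed.

(** In odd degree -p(-X) is monic as well, so p is positive far to the right and negative far to the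
    left; the intermediate value theorem applies. *)
Lemma odd_monic_has_root (R : rcfType) (p : {poly R}) :
  p \is monic -> odd (size p).-1 -> exists x, root p x.
Proof.
move=> p1 oddp; have [N pN] := monic_pinfty_ge1 p1.
have lc1 : lead_coef (- (p \Po - 'X)) = 1.
  rewrite lead_coefN lead_coef_comp ?size_polyN ?size_polyX // (monicP p1) mul1r.
  by rewrite lead_coefN lead_coefX -signr_odd oddp expr1 opprK.
have [|M pM] := @monic_pinfty_ge1 _ (- (p \Po - 'X)); first exact/monicP.
pose b := Num.max 0 (Num.max M N).
have b0 : 0 <= b by rewrite le_max lexx.
have [||x _ rx] := @polyrcf.poly_ivt _ p (- b) b; last by exists x.
  by rewrite (le_trans _ b0) // oppr_le0.
have pb : 0 <= p.[b] by rewrite (le_trans ler01) // pN // !le_max lexx !orbT.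
have pNb : p.[- b] <= 0.
  have := pM b; rewrite hornerN horner_comp hornerN hornerX !le_max lexx orbT.
  by move/(_ isT)/(le_trans ler01); rewrite oppr_ge0.
exact: mulr_le0_ge0.
Qed.

(** The characteristic polynomial has odd degree, hence a real root, and its finitely many real
    roots have a maximum. *)
Lemma odd_largest_eigenvalue (R : realType) (n : nat) (A : 'M[R]_n) :
  odd n -> exists l, largest_eigenvalue A l.
Proof.
move=> oddn; have [|x px] := odd_monic_has_root (char_poly_monic A).
  by rewrite size_char_poly.
have rP := polyrcf.roots_on_rootsR (monic_neq0 (char_poly_monic A)).
move: (polyrcf.rootsR _) rP => s rs.
have eigP l : eigenvalue A l = (l \in s) by rewrite eigenvalue_root_char -rs in_itv.
have max_seq (r : seq R) : r != [::] -> exists2 m, m \in r & forall y, y \in r -> y <= m.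
  elim: r => // y [|z r] IHr _.
    by exists y => [|w]; rewrite ?mem_head // inE => /eqP ->.
  have [//|m mr lem] := IHr; exists (Num.max y m).
    by case: (leP y m) => _; rewrite inE ?eqxx // mr orbT.
  by move=> w; rewrite inE le_max => /predU1P[->|/lem ->]; rewrite ?lexx ?orbT.
have [|m ms lem] := max_seq s.
  by apply: contraTneq px => s0; rewrite -eigenvalue_root_char eigP s0.
by exists m; split=> [|l]; rewrite eigP // => /lem.
Qed.

(** * Quadratic forms and null vectors of semidefinite matrices *)

Definition quad_form (R : pzRingType) (n : nat) (A : 'M[R]_n) (x : 'cV[R]_n) : R :=
  (x^T *m A *m x) 0 0.

Lemma quad_formE (R : comPzRingType) (n : nat) (A : 'M[R]_n) (x : 'cV[R]_n) :
  quad_form A x = \sum_a \sum_b x a 0 * x b 0 * A a b.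
Proof.
rewrite /quad_form mxE exchange_big; apply: eq_bigr => b _.
rewrite mxE mulr_suml; apply: eq_bigr => a _.
by rewrite mxE mulrAC.
Qed.

Lemma quad_form_scalar (R : comPzRingType) (n : nat) (c : R) (x : 'cV[R]_n) :
  quad_form c%:M x = c * \sum_a x a 0 ^+ 2.
Proof.
rewrite /quad_form mul_mx_scalar -scalemxAl !mxE; congr (_ * _).
by apply: eq_bigr => a _; rewrite mxE expr2.
Qed.

Lemma sum_sqr_gt0 (R : realDomainType) (n : nat) (x : 'cV[R]_n) :
  x != 0 -> 0 < \sum_a x a 0 ^+ 2.
Proof.
move=> x0; rewrite lt_neqAle sumr_ge0 ?andbT => [|a _]; last exact: sqr_ge0.
apply: contraNneq x0 => /esym/eqP.
rewrite psumr_eq0 => [/allP x0|a _]; last exact: sqr_ge0.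
apply/eqP/matrixP => a j; rewrite (ord1 j) mxE.
by apply/eqP; rewrite -sqrf_eq0; apply: x0; rewrite mem_index_enum.
Qed.

(* With y = M x, positivity along x + t y for small negative t forces |y|^2 = 0. *)
Lemma psd_null_vector (R : realFieldType) (n : nat) (M : 'M[R]_n) (x : 'cV[R]_n) :
  M^T = M -> (forall y, 0 <= quad_form M y) -> quad_form M x = 0 -> M *m x = 0.
Proof.
move=> symM psdM x0; apply/eqP; apply: contraT => /sum_sqr_gt0.
set y := M *m x; set s := \sum_a _ => s_gt0.
have yMx : (y^T *m M *m x) 0 0 = s.
  by rewrite -mulmxA mxE; apply: eq_bigr => a _; rewrite mxE expr2.
have xMy : (x^T *m M *m y) 0 0 = s.
  have -> : x^T *m M *m y = (y^T *m M *m x)^T.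
    by rewrite trmx_mul (trmx_mul y^T) trmxK symM mulmxA.
  by rewrite mxE.
have expand t : quad_form M (x + t *: y) = t *+ 2 * s + t ^+ 2 * quad_form M y.
  have tr_xy : (x + t *: y)^T = x^T + t *: y^T by apply/matrixP => i j; rewrite !mxE.
  rewrite /quad_form tr_xy !mulmxDl !mulmxDr -!scalemxAl -!scalemxAr.
  have mxD (B C : 'M[R]_1) : (B + C) 0 0 = B 0 0 + C 0 0 by rewrite mxE.
  have mxZ c (B : 'M[R]_1) : (c *: B) 0 0 = c * B 0 0 by rewrite mxE.
  rewrite !(mxD, mxZ) xMy yMx -/(quad_form M x) -/(quad_form M y) x0; ring.
(* The minimum of 2ts + t^2 q is at t = -s/q, but q may be zero. Replacing q by q + s > 0 in the
   denominator still gives a negative value, namely -s^2 (q + 2s) / (q + s)^2. *)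
have q0 := psdM y; have := psdM (x + (- s / (quad_form M y + s)) *: y).
rewrite expand; set q := quad_form M y in q0 *.
have qs : 0 < q + s by rewrite ltr_wpDl.
rewrite (_ : _ + _ = - (s ^+ 2 * (q + s *+ 2)) / (q + s) ^+ 2); last by field; rewrite gt_eqF.
rewrite pmulr_lge0 ?invr_gt0 ?exprn_gt0 // oppr_ge0 leNgt mulr_gt0 ?exprn_gt0 //.
by rewrite ltr_wpDl // mulrn_wgt0.
Qed.

(** * Quaternions, complex structures and the psi-operator in coordinates *)

(** Leaves [ring] and [lra] with plain variables in place of matrix entries. *)
Ltac generalize_entries D := repeat
  match goal with |- context [fun_of_matrix D ?i ?j] => move: (D i j) => ? end.

Section Coordinates.
Variable R : realType.
Implicit Types (p q v w : quaternion R) (D : 'M[R]_4).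

Lemma quatE (a b c d : R) : ((quat a b c d 0 0 = a) * (quat a b c d 0 1 = b) *
  (quat a b c d 0 2%:R = c) * (quat a b c d 0 3%:R = d))%type.
Proof. by rewrite /quat !mxE. Qed.

Lemma coordD v w i : (v + w) 0 i = v 0 i + w 0 i. Proof. exact: mxE. Qed.

Lemma coordN v i : (- v) 0 i = - v 0 i. Proof. exact: mxE. Qed.

Lemma coordZ c v i : (c *: v) 0 i = c * v 0 i. Proof. exact: mxE. Qed.

Definition coordE := (coordD, coordN, coordZ).

Lemma quaternionP v w : [/\ v 0 0 = w 0 0, v 0 1 = w 0 1, v 0 2%:R = w 0 2%:R
  & v 0 3%:R = w 0 3%:R] -> v = w.
Proof. by move=> vw; apply/rowP/forall_ord4. Qed.

Lemma imE v : ((im v 0 = v 0 1) * (im v 1 = v 0 2%:R) * (im v 2%:R = v 0 3%:R))%type.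
Proof. by split; [split|]; congr (v 0 _); apply: val_inj. Qed.

Lemma sum_ord4 (V : nmodType) (F : 'I_4 -> V) :
  \sum_i F i = F 0 + F 1 + F 2%:R + F 3%:R.
Proof.
rewrite !big_ord_recr big_ord0 /= add0r.
by do ?congr (_ + _); congr F; apply: val_inj.
Qed.

Lemma sum_ord3 (V : nmodType) (F : 'I_3 -> V) : \sum_i F i = F 0 + F 1 + F 2%:R.
Proof.
rewrite !big_ord_recr big_ord0 /= add0r.
by do ?congr (_ + _); congr F; apply: val_inj.
Qed.

Lemma forall_ord3 (P : 'I_3 -> Prop) : (forall i, P i) <-> [/\ P 0, P 1 & P 2%:R].
Proof.
split=> [PH|[P0 P1 P2] i]; first by split; exact: PH.
by case: i => [[|[|[|//]]] Hi]; [have := P0 | have := P1 | have := P2];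
  congr P; apply: val_inj.
Qed.

Lemma iunitE : ((iunit R 0 = qi R) * (iunit R 1 = qj R) * (iunit R 2%:R = qk R))%type.
Proof. by []. Qed.

Lemma qmulE p v : qmul p v =
  quat (p 0 0 * v 0 0 - p 0 1 * v 0 1 - p 0 2%:R * v 0 2%:R - p 0 3%:R * v 0 3%:R)
       (p 0 0 * v 0 1 + p 0 1 * v 0 0 + p 0 2%:R * v 0 3%:R - p 0 3%:R * v 0 2%:R)
       (p 0 0 * v 0 2%:R - p 0 1 * v 0 3%:R + p 0 2%:R * v 0 0 + p 0 3%:R * v 0 1)
       (p 0 0 * v 0 3%:R + p 0 1 * v 0 2%:R - p 0 2%:R * v 0 1 + p 0 3%:R * v 0 0).
Proof. by rewrite /qmul !imE. Qed.

Lemma Jbase0E v : Jbase 0 v = quat (- v 0 1) (v 0 0) (- v 0 3%:R) (v 0 2%:R).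
Proof.
rewrite /Jbase (tnth_nth (@J1 R)) /= /J1 qmulE /qi !quatE.
by apply: quaternionP; rewrite !quatE; split; ring.
Qed.

Lemma Jbase1E v : Jbase 1 v = quat (- v 0 2%:R) (v 0 3%:R) (v 0 0) (- v 0 1).
Proof.
rewrite /Jbase (tnth_nth (@J1 R)) /= /J2 qmulE /qj !quatE.
by apply: quaternionP; rewrite !quatE; split; ring.
Qed.

(** This is left multiplication by -k, not k; the sign agrees with the one in front of the last
    derivative in psi-regularity. *)
Lemma Jbase2E v : Jbase 2%:R v = quat (v 0 3%:R) (v 0 2%:R) (- v 0 1) (- v 0 0).
Proof.
rewrite /Jbase (tnth_nth (@J1 R)) /= /J3 /J1 /J2 !qmulE /qi /qj !quatE.
by apply: quaternionP; rewrite !coordE !quatE; split; ring.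
Qed.

Definition JbaseE := (Jbase0E, Jbase1E, Jbase2E).

Lemma JstructE p v : Jstruct p v =
  quat (- p 0 1 * v 0 1 - p 0 2%:R * v 0 2%:R + p 0 3%:R * v 0 3%:R)
       (p 0 1 * v 0 0 + p 0 2%:R * v 0 3%:R + p 0 3%:R * v 0 2%:R)
       (- p 0 1 * v 0 3%:R + p 0 2%:R * v 0 0 - p 0 3%:R * v 0 1)
       (p 0 1 * v 0 2%:R - p 0 2%:R * v 0 1 - p 0 3%:R * v 0 0).
Proof.
rewrite /Jstruct sum_ord3 !imE !JbaseE.
by apply: quaternionP; rewrite !coordE !quatE /=; split; ring.
Qed.

Lemma sphere2P p : sphere2 p <->
  p 0 0 = 0 /\ p 0 1 ^+ 2 + p 0 2%:R ^+ 2 + p 0 3%:R ^+ 2 = 1.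
Proof.
rewrite /sphere2 /= qmulE /qone; split=> [pp|[p0 p1]]; last first.
  by apply: quaternionP; rewrite !coordE !quatE p0; split; try ring; rewrite -p1; ring.
have := congr1 (fun v : quaternion R => v 0 0) pp.
have := congr1 (fun v : quaternion R => v 0 1) pp.
have := congr1 (fun v : quaternion R => v 0 2%:R) pp.
have := congr1 (fun v : quaternion R => v 0 3%:R) pp.
rewrite !coordE !quatE => e3 e2 e1 e0.
(* A nonzero real part would make the imaginary part vanish, and then p^2 would be a nonnegative
   real number. *)
have p0 : p 0 0 = 0 by nra.
by split=> //; move: e0; rewrite p0; lra.
Qed.

Fact Lmul_is_linear p : linear (Lmul p).
Proof.
move=> c v w; rewrite /Lmul !qmulE.
by apply: quaternionP; rewrite !coordE !quatE; split; ring.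
Qed.

HB.instance Definition _ p :=
  GRing.isLinear.Build R (quaternion R) (quaternion R) _ (Lmul p) (Lmul_is_linear p).

Fact Jbase_is_linear a : linear (@Jbase R a).
Proof.
move: a; apply/forall_ord3; split=> c v w; rewrite !JbaseE;
  by apply: quaternionP; rewrite !coordE !quatE; split; ring.
Qed.

HB.instance Definition _ a := GRing.isLinear.Build R (quaternion R) (quaternion R) _
  (@Jbase R a) (Jbase_is_linear a).

Fact Jstruct_is_linear p : linear (Jstruct p).
Proof.
move=> c v w; rewrite !JstructE.
by apply: quaternionP; rewrite !coordE !quatE; split; ring.
Qed.

HB.instance Definition _ p := GRing.isLinear.Build R (quaternion R) (quaternion R) _
  (Jstruct p) (Jstruct_is_linear p).

Definition frob (A B : 'M[R]_4) : R := \sum_i \sum_j A i j * B i j.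

Lemma hs_innerE (S T : quaternion R -> quaternion R) :
  hs_inner S T = frob (lin1_mx S) (lin1_mx T).
Proof.
rewrite /hs_inner /colmx trmxK /mxtrace /frob; apply: eq_bigr => i _.
by rewrite mxE; apply: eq_bigr => j _; congr (_ * _); exact: mxE.
Qed.

Lemma lin1_mx_comp (S T : {linear quaternion R -> quaternion R}) :
  lin1_mx (S \o T) = lin1_mx T *m lin1_mx S.
Proof. by apply/row_matrixP => i; rewrite !rowE mulmxA !mul_rV_lin1. Qed.

(* Matrices act on row vectors from the right, so L_{i_b} o D o J_a is written
   in the order J_a, D, L_{i_b}. *)
Definition twist (a b : 'I_3) D : 'M[R]_4 :=
  lin1_mx (Jbase a) *m D *m lin1_mx (Lmul (iunit R b)).

(** The map Q_p. The maps Q_1, Q_2, Q_3 are the diagonal cases [twist a a]. *)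
Definition twistp p D : 'M[R]_4 := lin1_mx (Jstruct p) *m D *m lin1_mx (Lmul p).

Lemma row_sandwichE (J L : {linear quaternion R -> quaternion R}) D i :
  row i (lin1_mx J *m D *m lin1_mx L) = L (J (delta_mx 0 i) *m D).
Proof. by rewrite rowE !mulmxA !mul_rV_lin1. Qed.

Lemma twistE a b D i j :
  twist a b D i j = Lmul (iunit R b) (Jbase a (delta_mx 0 i) *m D) 0 j.
Proof. by rewrite -row_sandwichE [RHS]mxE. Qed.

Lemma twistpE p D i j : twistp p D i j = Lmul p (Jstruct p (delta_mx 0 i) *m D) 0 j.
Proof. by rewrite -row_sandwichE [RHS]mxE. Qed.

Lemma deltaE : ((delta_mx 0 0 = quat 1 0 0 0 :> quaternion R) *
  (delta_mx 0 1 = quat 0 1 0 0 :> quaternion R) *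
  (delta_mx 0 2%:R = quat 0 0 1 0 :> quaternion R) *
  (delta_mx 0 3%:R = quat 0 0 0 1 :> quaternion R))%type.
Proof. by do ?split; apply: quaternionP; rewrite !quatE !mxE. Qed.

Lemma coord_row D i j : row i D 0 j = D i j. Proof. exact: mxE. Qed.

(** Row i of [D] stands for the i-th partial derivative, so this is the left-hand side of the
    equation of psi-regularity. *)
Definition psi_op D : quaternion R :=
  row 0 D + qmul (qi R) (row 1 D) + qmul (qj R) (row 2%:R D) - qmul (qk R) (row 3%:R D).

Lemma psi_opE D : psi_op D =
  quat (D 0 0 - D 1 1 - D 2%:R 2%:R + D 3%:R 3%:R)
       (D 0 1 + D 1 0 + D 2%:R 3%:R + D 3%:R 2%:R)
       (D 0 2%:R - D 1 3%:R + D 2%:R 0 - D 3%:R 1)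
       (D 0 3%:R + D 1 2%:R - D 2%:R 1 - D 3%:R 0).
Proof.
rewrite /psi_op /qi /qj /qk !qmulE.
by apply: quaternionP; rewrite !(coordE, quatE, coord_row); split; ring.
Qed.

(** Precomposition with J_a permutes the rows of [D] up to sign. With these rules, inner products
    with twists become explicit polynomials in the entries. *)
Lemma Jbase_rowE D : (
  (Jbase 0 (delta_mx 0 0) *m D = row 1 D) * (Jbase 0 (delta_mx 0 1) *m D = - row 0 D) *
  (Jbase 0 (delta_mx 0 2%:R) *m D = row 3%:R D) *
  (Jbase 0 (delta_mx 0 3%:R) *m D = - row 2%:R D) *
  (Jbase 1 (delta_mx 0 0) *m D = row 2%:R D) * (Jbase 1 (delta_mx 0 1) *m D = - row 3%:R D) *
  (Jbase 1 (delta_mx 0 2%:R) *m D = - row 0 D) *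
  (Jbase 1 (delta_mx 0 3%:R) *m D = row 1 D) *
  (Jbase 2%:R (delta_mx 0 0) *m D = - row 3%:R D) *
  (Jbase 2%:R (delta_mx 0 1) *m D = - row 2%:R D) *
  (Jbase 2%:R (delta_mx 0 2%:R) *m D = row 1 D) *
  (Jbase 2%:R (delta_mx 0 3%:R) *m D = row 0 D))%type.
Proof.
rewrite !rowE -!mulNmx !JbaseE !deltaE.
by do !split; congr (_ *m D); apply: quaternionP; rewrite ?coordN !quatE ?oppr0.
Qed.

Lemma Lmul_iunitE v : (
  (Lmul (iunit R 0) v = quat (- v 0 1) (v 0 0) (- v 0 3%:R) (v 0 2%:R)) *
  (Lmul (iunit R 1) v = quat (- v 0 2%:R) (v 0 3%:R) (v 0 0) (- v 0 1)) *
  (Lmul (iunit R 2%:R) v = quat (- v 0 3%:R) (- v 0 2%:R) (v 0 1) (v 0 0)))%type.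
Proof.
rewrite /Lmul !iunitE /qi /qj /qk !qmulE !quatE.
by do !split; apply: quaternionP; rewrite !quatE; split; ring.
Qed.

(** The four terms of psi(D) have squared norms adding up to |D|^2. Their six cross terms are shared
    out in pairs: rows 0,1 and 2,3 give <D, Q_1 D>, rows 0,2 and 1,3 give <D, Q_2 D>, rows 0,3 and
    1,2 give <D, Q_3 D>. *)
Lemma frob_psi_op D :
  frob D D + \sum_a frob D (twist a a D) = \sum_j psi_op D 0 j ^+ 2.
Proof.
rewrite psi_opE /frob sum_ord3 !sum_ord4 !quatE !twistE !Jbase_rowE !Lmul_iunitE.
rewrite !quatE !coordN !coord_row.
generalize_entries D; ring.
Qed.

Lemma frob_twistC a b D : psi_op D = 0 -> frob D (twist a b D) = frob D (twist b a D).
Proof.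
rewrite psi_opE => psi0.
have := congr1 (fun v : quaternion R => v 0 0) psi0.
have := congr1 (fun v : quaternion R => v 0 1) psi0.
have := congr1 (fun v : quaternion R => v 0 2%:R) psi0.
have := congr1 (fun v : quaternion R => v 0 3%:R) psi0.
rewrite !quatE !(mxE _ _ 0) => e3 e2 e1 e0.
(* The equation psi(D) = 0 expresses row 0 through the other three rows; after this elimination the
   symmetry is a polynomial identity. *)
have {e0}e0 : D 0 0 = D 1 1 + D 2%:R 2%:R - D 3%:R 3%:R by move: e0; generalize_entries D; lra.
have {e1}e1 : D 0 1 = - D 1 0 - D 2%:R 3%:R - D 3%:R 2%:R by move: e1; generalize_entries D; lra.
have {e2}e2 : D 0 2%:R = D 1 3%:R - D 2%:R 0 + D 3%:R 1 by move: e2; generalize_entries D; lra.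
have {e3}e3 : D 0 3%:R = - D 1 2%:R + D 2%:R 1 + D 3%:R 0 by move: e3; generalize_entries D; lra.
move: a b; apply/forall_ord3; split; apply/forall_ord3; split => //;
  rewrite /frob !sum_ord4 !twistE !Jbase_rowE !Lmul_iunitE !quatE ?coordN !coord_row;
  rewrite e0 e1 e2 e3; generalize_entries D; ring.
Qed.

End Coordinates.

(** * The Frobenius inner product and the isometries Q_p *)

Section Twist.
Variable R : realType.
Implicit Types (p : quaternion R) (A B D : 'M[R]_4).

Lemma frobDl A B D : frob (A + B) D = frob A D + frob B D.
Proof.
rewrite /frob -big_split; apply: eq_bigr => i _; rewrite -big_split.
by apply: eq_bigr => j _; rewrite mxE mulrDl.
Qed.

Lemma frobC A B : frob A B = frob B A.
Proof. by apply: eq_bigr => i _; apply: eq_bigr => j _; rewrite mulrC. Qed.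

Lemma frobZr c A B : frob A (c *: B) = c * frob A B.
Proof.
rewrite /frob mulr_sumr; apply: eq_bigr => i _; rewrite mulr_sumr.
by apply: eq_bigr => j _; rewrite mxE mulrCA.
Qed.

Lemma frob_sumr (I : finType) A (F : I -> 'M[R]_4) :
  frob A (\sum_k F k) = \sum_k frob A (F k).
Proof.
rewrite (big_morph (frob A) (id1 := 0) (op1 := +%R)) // => [B D|].
  by rewrite frobC frobDl !(frobC _ A).
by rewrite -(scale0r A) frobZr mul0r.
Qed.

Lemma frob_ge0 A : 0 <= frob A A.
Proof. by apply: sumr_ge0 => i _; apply: sumr_ge0 => j _; rewrite -expr2 sqr_ge0. Qed.

Lemma frob_eq0 A : frob A A = 0 -> A = 0.
Proof.
move=> A0; apply/matrixP => i j; rewrite mxE; apply/eqP; rewrite -sqrf_eq0 expr2.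
have Ai k : 0 <= \sum_l A k l * A k l by apply: sumr_ge0 => l _; rewrite -expr2 sqr_ge0.
have Ai0 : \sum_l A i l * A i l = 0.
  by apply: (psumr_eq0P (P := predT) (F := fun k => \sum_l A k l * A k l)).
apply/eqP; apply: (psumr_eq0P (P := predT) (F := fun l => A i l * A i l)) => //.
by move=> l _; rewrite -expr2 sqr_ge0.
Qed.

(** J_p sees only the imaginary part of p, while L_p also involves the real part; when the latter is
    zero both are linear in X_p. Hence <D, Q_p D> is a quadratic form in X_p. *)
Lemma twistp_sum p D : p 0 0 = 0 ->
  twistp p D = \sum_a \sum_b (im p a * im p b) *: twist a b D.
Proof.
move=> p0.
have Jp : lin1_mx (Jstruct p) = \sum_a im p a *: lin1_mx (Jbase a).
  apply/matrixP => i j; rewrite mxE /Jstruct !summxE; apply: eq_bigr => a _.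
  by rewrite !mxE.
have Lp : lin1_mx (Lmul p) = \sum_b im p b *: lin1_mx (Lmul (iunit R b)).
  apply/row_matrixP => i; rewrite rowE mul_rV_lin1 raddf_sum /=.
  under eq_bigr do rewrite linearZ /= rowE mul_rV_lin1.
  rewrite sum_ord3 /= !Lmul_iunitE !imE /Lmul qmulE p0.
  by apply: quaternionP; rewrite !(coordE, quatE); split; ring.
rewrite /twistp Jp Lp mulmx_suml mulmx_suml; apply: eq_bigr => a _.
rewrite mulmx_sumr; apply: eq_bigr => b _.
by rewrite -!scalemxAl -scalemxAr scalerA.
Qed.

Lemma frob_twistp_sum p D : p 0 0 = 0 ->
  frob D (twistp p D) = \sum_a \sum_b im p a * im p b * frob D (twist a b D).
Proof.
move=> p0; rewrite twistp_sum // frob_sumr; apply: eq_bigr => a _.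
by rewrite frob_sumr; apply: eq_bigr => b _; rewrite frobZr.
Qed.

(** Multiplicativity of the quaternion norm. *)
Lemma Lmul_sqr p v : \sum_j (Lmul p v) 0 j ^+ 2 =
  (p 0 0 ^+ 2 + p 0 1 ^+ 2 + p 0 2%:R ^+ 2 + p 0 3%:R ^+ 2) * \sum_j v 0 j ^+ 2.
Proof.
rewrite /Lmul qmulE !sum_ord4 !quatE.
generalize_entries p; generalize_entries v; ring.
Qed.

(** The matrix of J_p is an orthogonal matrix scaled by the norm of the imaginary part of p, so it
    scales the norms of column vectors too. *)
Lemma Jstruct_sqr p (c : 'cV[R]_4) :
  \sum_i (Jstruct p (delta_mx 0 i) *m c) 0 0 ^+ 2 =
  (p 0 1 ^+ 2 + p 0 2%:R ^+ 2 + p 0 3%:R ^+ 2) * \sum_i c i 0 ^+ 2.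
Proof.
rewrite !sum_ord4 !deltaE !JstructE !quatE.
have coordc w : (w *m c) 0 0 =
    w 0 0 * c 0 0 + w 0 1 * c 1 0 + w 0 2%:R * c 2%:R 0 + w 0 3%:R * c 3%:R 0.
  by rewrite mxE sum_ord4.
rewrite !coordc !quatE.
generalize_entries p; generalize_entries c; ring.
Qed.

(** L_p preserves the norm of each row, and J_p the norm of each column; the sums are exchanged
    between the two arguments. *)
Lemma frob_twistp p D : sphere2 p -> frob (twistp p D) (twistp p D) = frob D D.
Proof.
move=> /sphere2P[p0 p1].
transitivity (\sum_i \sum_j (Jstruct p (delta_mx 0 i) *m D) 0 j ^+ 2).
  apply: eq_bigr => i _.
  have := Lmul_sqr p (Jstruct p (delta_mx 0 i) *m D).
  rewrite p0 expr0n add0r p1 mul1r => <-.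
  by apply: eq_bigr => j _; rewrite twistpE -expr2.
rewrite exchange_big [RHS]exchange_big; apply: eq_bigr => j _.
transitivity (\sum_i (Jstruct p (delta_mx 0 i) *m col j D) 0 0 ^+ 2).
  by apply: eq_bigr => i _; rewrite colE mulmxA -colE [in RHS]mxE.
by rewrite Jstruct_sqr p1 mul1r; apply: eq_bigr => i _; rewrite mxE expr2.
Qed.

Lemma frob_add_twistp p D : sphere2 p ->
  frob (D + twistp p D) (D + twistp p D) = 2 * (frob D D + frob D (twistp p D)).
Proof.
move=> p1; rewrite frobDl !(frobC _ (_ + _)) !frobDl frob_twistp //.
by rewrite (frobC (twistp p D) D); ring.
Qed.

End Twist.

(** * Integral formulas for the energy and for the matrix A *)

Section Energy.
Variables (R : realType) (Omega : set (quaternion R)).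
Variable f : quaternion R -> quaternion R.

(** The transpose of the usual Jacobian matrix, since it acts on row vectors from the right. It
    represents the differential at points of [Omega]. *)
Definition jac (x : quaternion R) : 'M[R]_4 := \matrix_(i, j) partial i f x 0 j.

Hypotheses (oO : open Omega) (bO : bounded_set Omega) (fC1 : C1_closure Omega f).

Let f_diff x : Omega x -> differentiable f x.
Proof. by case: fC1 => -[df _] _ _; exact: df. Qed.

Lemma jacE x : Omega x -> lin1_mx ('d f x) = jac x.
Proof.
move=> Ox; apply/matrixP => i j; rewrite !mxE /partial deriveE //; exact: f_diff.
Qed.

Lemma diff_jac x v : Omega x -> 'd f x v = v *m jac x.
Proof. by move=> Ox; rewrite -jacE // mul_rV_lin1. Qed.

Lemma closure_bounded_set : bounded_set (closure Omega).
Proof.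
case: bO => M [_ OM]; exists (M + 1); split=> [|y My x]; first exact: num_real.
have Oy : Omega `<=` [set x | `|x| <= y].
  by apply: OM; rewrite (lt_trans _ My) // ltrDl.
have cy : closed [set x : quaternion R | `|x| <= y].
  apply: (@closed_comp _ _ (fun x : quaternion R => `|x|) [set r | r <= y]).
    by move=> z _; exact: norm_continuous.
  exact: closed_le.
by move: cy => /closure_id ->; exact: closureS.
Qed.

(** Boundedness comes from the extension of the partial derivatives to the closure of [Omega], which
    is compact. *)
Lemma jac_bounded_continuous i j : bounded_continuous Omega (fun x => jac x i j).
Proof.
have -> : (fun x => jac x i j) = (fun v : quaternion R => v 0 j) \o partial i f.
  by apply/funext => x; rewrite mxE.
case: fC1 => -[_ /(_ i) cf] _ /(_ i) [g cg gf]; split=> [x xO|].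
  apply: continuous_comp; last exact: coord_continuous.
  by move: cf; rewrite continuous_open_subspace //; exact.
have /compact_bounded[M [_ gM]] : compact (g @` closure Omega).
  apply: continuous_compact => //.
  by apply: bounded_closed_compact; [exact: closure_bounded_set|exact: closed_closure].
exists (`|M| + 1) => x Ox /=; apply: le_trans (gM (`|M| + 1) _ (g x) _).
- rewrite gf // [leRHS]mx_normrE.
  exact: (le_bigmax _ (fun ij => `|partial i f x ij.1 ij.2|) (0, j)).
- by rewrite (le_lt_trans (ler_norm _))// ltrDl.
- by exists x => //; exact: subset_closure.
Qed.

Lemma mulmx_bounded_continuous (F G : quaternion R -> 'M[R]_4) :
  (forall i j, bounded_continuous Omega (fun x => F x i j)) ->
  (forall i j, bounded_continuous Omega (fun x => G x i j)) ->
  forall i j, bounded_continuous Omega (fun x => (F x *m G x) i j).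
Proof.
move=> bF bG i j; under eq_fun do rewrite mxE.
by apply: bounded_continuous_sum => k; exact: bounded_continuousM.
Qed.

Lemma frob_bounded_continuous (F G : quaternion R -> 'M[R]_4) :
  (forall i j, bounded_continuous Omega (fun x => F x i j)) ->
  (forall i j, bounded_continuous Omega (fun x => G x i j)) ->
  bounded_continuous Omega (fun x => frob (F x) (G x)).
Proof.
move=> bF bG; apply: bounded_continuous_sum => i; apply: bounded_continuous_sum => j.
exact: bounded_continuousM.
Qed.

Lemma sandwich_bounded_continuous (J L : 'M[R]_4) i j :
  bounded_continuous Omega (fun x => (J *m jac x *m L) i j).
Proof.
apply: (mulmx_bounded_continuous (F := fun x => J *m jac x) (G := fun=> L)) => k l.
  apply: (mulmx_bounded_continuous (F := fun=> J)) => m n.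
    exact: bounded_continuous_cst.
  exact: jac_bounded_continuous.
exact: bounded_continuous_cst.
Qed.

Let bc_frob_jac : bounded_continuous Omega (fun x => frob (jac x) (jac x)).
Proof. by apply: frob_bounded_continuous; exact: jac_bounded_continuous. Qed.

Let bc_frob_twist a b :
  bounded_continuous Omega (fun x => frob (jac x) (twist a b (jac x))).
Proof.
apply: frob_bounded_continuous; first exact: jac_bounded_continuous.
exact: sandwich_bounded_continuous.
Qed.

Lemma energyE : energy Omega f = 2^-1 * vol_integral Omega (fun x => frob (jac x) (jac x)).
Proof.
congr (_ * _); apply: eq_vol_integral => x Ox.
by rewrite hs_innerE jacE.
Qed.

Lemma energy_mxE a b : energy_mx Omega f a b =
  - (2^-1 * vol_integral Omega (fun x => frob (jac x) (twist a b (jac x)))).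
Proof.
rewrite mxE -vol_integralZ //; congr (- _); apply: eq_vol_integral => x Ox.
by rewrite /pullback_inner hs_innerE !lin1_mx_comp mulmxA jacE.
Qed.

Lemma energy_sub_trace : energy Omega f - \tr (energy_mx Omega f) =
  2^-1 * vol_integral Omega (fun x => \sum_j psi_op (jac x) 0 j ^+ 2).
Proof.
rewrite energyE /mxtrace -sumrN.
under eq_bigr do rewrite energy_mxE opprK.
rewrite -mulr_sumr -mulrDr -vol_integral_sum // -vol_integralD //.
  by congr (_ * _); apply: eq_vol_integral => x _; rewrite frob_psi_op.
exact: bounded_continuous_sum.
Qed.

Lemma energy_sub_quad_form p : sphere2 p ->
  energy Omega f - quad_form (energy_mx Omega f) (imvec p) = 4^-1 * vol_integral Omega
    (fun x => frob (jac x + twistp p (jac x)) (jac x + twistp p (jac x))).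
Proof.
move=> p1; have [p0 _] := (sphere2P p).1 p1.
rewrite energyE quad_formE.
have bt a b : bounded_continuous Omega
    (fun x => im p a * im p b * frob (jac x) (twist a b (jac x))).
  by apply: bounded_continuousM => //; exact: bounded_continuous_cst.
have -> : \sum_a \sum_b imvec p a 0 * imvec p b 0 * energy_mx Omega f a b =
    - (2^-1 * vol_integral Omega (fun x => frob (jac x) (twistp p (jac x)))).
  rewrite -[RHS]mulN1r mulrA.
  rewrite (eq_vol_integral (fun x _ => frob_twistp_sum (jac x) p0)).
  rewrite vol_integral_sum // => [|a]; last exact: bounded_continuous_sum.
  rewrite mulr_sumr; apply: eq_bigr => a _; rewrite vol_integral_sum // mulr_sumr.
  apply: eq_bigr => b _; rewrite vol_integralZ // energy_mxE !mxE; ring.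
rewrite opprK -mulrDr -vol_integralD //; last first.
  apply: frob_bounded_continuous; first exact: jac_bounded_continuous.
  exact: sandwich_bounded_continuous.
(* The factor 2 is the one in |D + Q_p D|^2 = 2 (|D|^2 + <D, Q_p D>). *)
rewrite (_ : 2^-1 = 4^-1 * 2 :> R); last by field.
rewrite -mulrA -vol_integralZ //; last first.
  apply: bounded_continuousD => //.
  apply: frob_bounded_continuous; first exact: jac_bounded_continuous.
  exact: sandwich_bounded_continuous.
by congr (_ * _); apply: eq_vol_integral => x _; rewrite frob_add_twistp.
Qed.

Lemma psi_regularP : psi_regular Omega f <-> forall x, Omega x -> psi_op (jac x) = 0.
Proof.
have rowj i x : row i (jac x) = partial i f x by apply/rowP => j; rewrite !mxE.
split=> [[_ psi0] x Ox|psi0]; first by rewrite /psi_op !rowj psi0.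
by split=> [|x /psi0]; [case: fC1|rewrite /psi_op !rowj].
Qed.

Lemma HolP p : Hol p Omega f <-> forall x, Omega x -> jac x + twistp p (jac x) = 0.
Proof.
have twistv x v : Omega x ->
    'd f x v + Lmul p ('d f x (Jstruct p v)) = v *m (jac x + twistp p (jac x)).
  by move=> Ox; rewrite mulmxDr /twistp !mulmxA !mul_rV_lin1 !diff_jac.
split=> [[_ hol0] x Ox|hol0].
  by apply/row_matrixP => i; rewrite rowE -twistv // hol0 // row0.
by split=> [|x Ox v]; [case: fC1|rewrite twistv // hol0 // mulmx0].
Qed.

Lemma psi_regular_energy : psi_regular Omega f <-> energy Omega f = \tr (energy_mx Omega f).
Proof.
split=> [/psi_regularP psi0|Etr].
  apply/eqP; rewrite -subr_eq0 energy_sub_trace; rewrite (@eq_vol_integral _ _ _ (fun=> 0)).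
    by rewrite vol_integral0 // mulr0.
  by move=> x Ox; rewrite psi0 // big1 // => j _; rewrite mxE expr0n.
have int0 : vol_integral Omega (fun x => \sum_j psi_op (jac x) 0 j ^+ 2) = 0.
  apply: (@mulfI _ 2^-1); first by rewrite invr_eq0 pnatr_eq0.
  by rewrite -energy_sub_trace Etr subrr mulr0.
have psi2 v : 0 <= \sum_j (v : quaternion R) 0 j ^+ 2.
  by apply: sumr_ge0 => j _; exact: sqr_ge0.
have bc : bounded_continuous Omega (fun x => \sum_j psi_op (jac x) 0 j ^+ 2).
  (* Read backwards, the pointwise identity writes |psi(D)|^2 as a sum of inner products already
     known to be bounded and continuous. *)
  under eq_fun do rewrite -frob_psi_op.
  by apply: bounded_continuousD => //; exact: bounded_continuous_sum.
apply/psi_regularP => x Ox; apply/rowP => j; rewrite [RHS]mxE; apply/eqP.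
have := vol_integral_eq0 oO bO bc (fun y _ => psi2 _) int0 Ox.
by move=> /psumr_eq0P psi0; rewrite -sqrf_eq0 psi0 // => k _; exact: sqr_ge0.
Qed.

Lemma quad_form_le_energy p : sphere2 p ->
  quad_form (energy_mx Omega f) (imvec p) <= energy Omega f.
Proof.
move=> p1; rewrite -subr_ge0 energy_sub_quad_form // mulr_ge0 //.
by apply: vol_integral_ge0 => x _; exact: frob_ge0.
Qed.

Lemma Hol_energy p : sphere2 p ->
  Hol p Omega f <-> quad_form (energy_mx Omega f) (imvec p) = energy Omega f.
Proof.
move=> p1; split=> [/HolP hol0|Eq].
  apply/esym/eqP; rewrite -subr_eq0 energy_sub_quad_form //.
  rewrite (@eq_vol_integral _ _ _ (fun=> 0)).
    by rewrite vol_integral0 // mulr0.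
  move=> x Ox; rewrite hol0 // /frob big1 // => i _; rewrite big1 // => j _.
  by rewrite mxE mul0r.
have int0 : vol_integral Omega
    (fun x => frob (jac x + twistp p (jac x)) (jac x + twistp p (jac x))) = 0.
  apply: (@mulfI _ 4^-1); first by rewrite invr_eq0 pnatr_eq0.
  by rewrite -energy_sub_quad_form // Eq subrr mulr0.
apply/HolP => x Ox; apply: frob_eq0.
apply: (vol_integral_eq0 oO bO _ _ int0 Ox) => [|y _]; last exact: frob_ge0.
have bJL i j : bounded_continuous Omega (fun x => (jac x + twistp p (jac x)) i j).
  under eq_fun do rewrite mxE; apply: bounded_continuousD.
    exact: jac_bounded_continuous.
  exact: sandwich_bounded_continuous.
exact: frob_bounded_continuous.
Qed.

Lemma energy_mx_sym : psi_regular Omega f -> (energy_mx Omega f)^T = energy_mx Omega f.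
Proof.
move=> /psi_regularP psi0; apply/matrixP => a b; rewrite mxE !energy_mxE.
by congr (- (_ * _)); apply: eq_vol_integral => x /psi0; exact: frob_twistC.
Qed.

End Energy.

(** * Eigenvectors of symmetric matrices and unit imaginary quaternions *)

Lemma eigenvalue_det (F : fieldType) (n : nat) (A : 'M[F]_n) (t : F) :
  eigenvalue A t = (\det (A - t%:M) == 0).
Proof.
rewrite eigenvalue_root_char rootE horner_char_poly -opprB -scaleN1r detZ.
by rewrite mulf_eq0 signr_eq0.
Qed.

(** Symmetry lets transposition exchange the row eigenvectors of [eigenvalue] with the column
    eigenvectors X_p. *)
Lemma eigenvalue_sym (F : fieldType) (n : nat) (A : 'M[F]_n) (t : F) : A^T = A ->
  eigenvalue A t <-> exists2 x : 'cV_n, A *m x = t *: x & x != 0.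
Proof.
move=> symA; split=> [/eigenvalueP[v vA v0]|[x Ax x0]].
  exists v^T; last by rewrite trmx_eq0.
  by rewrite -{1}symA -trmx_mul vA linearZ.
apply/eigenvalueP; exists x^T; last by rewrite trmx_eq0.
by rewrite -{1}symA -trmx_mul Ax linearZ.
Qed.

Lemma sphere2_imvec_sqr (R : realType) (p : quaternion R) :
  sphere2 p -> \sum_a imvec p a 0 ^+ 2 = 1.
Proof. by move=> /sphere2P[_ p1]; rewrite sum_ord3 !mxE !imE. Qed.

Lemma imvec_neq0 (R : realType) (p : quaternion R) : sphere2 p -> imvec p != 0.
Proof.
move=> /sphere2_imvec_sqr p1; apply/eqP => p0; move: p1; rewrite p0 big1 => [/eqP|a _].
  by rewrite eq_sym oner_eq0.
by rewrite mxE expr0n.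
Qed.

(** Normalization: with homogeneity, facts about X_p for p in the sphere extend to all nonzero
    vectors. *)
Lemma unit_imvec (R : realType) (x : 'cV[R]_3) : x != 0 ->
  exists2 p, sphere2 p & exists2 c, c != 0 & x = c *: imvec p.
Proof.
move=> /sum_sqr_gt0; set s := \sum_a _ => s0; pose c := Num.sqrt s.
have c0 : c != 0 by rewrite sqrtr_eq0 -ltNge.
have c2 : c ^+ 2 = s by rewrite sqr_sqrtr // ltW.
exists (quat 0 (x 0 0 / c) (x 1 0 / c) (x 2%:R 0 / c)).
  apply/sphere2P; rewrite !quatE; split=> //.
  rewrite !expr_div_n -!mulrDl c2 (_ : _ + _ + _ = s); last by rewrite /s sum_ord3.
  by rewrite divff // gt_eqF.
exists c => //; apply/colP/forall_ord3.
by split; rewrite !mxE !imE !quatE mulrC divfK.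
Qed.

Lemma quad_formZ (R : comPzRingType) (n : nat) (A : 'M[R]_n) (c : R) (x : 'cV[R]_n) :
  quad_form A (c *: x) = c ^+ 2 * quad_form A x.
Proof.
rewrite !quad_formE mulr_sumr; apply: eq_bigr => a _; rewrite mulr_sumr.
by apply: eq_bigr => b _; rewrite !mxE; ring.
Qed.

(** * The spectrum of A compared with the energy *)

Section Spectrum.
Variables (R : realType) (Omega : set (quaternion R)).
Variable f : quaternion R -> quaternion R.
Hypotheses (oO : open Omega) (bO : bounded_set Omega) (fC1 : C1_closure Omega f).
Local Notation A := (energy_mx Omega f).
Local Notation E := (energy Omega f).

Lemma energy_sub_mx_psd x : 0 <= quad_form (E%:M - A) x.
Proof.
have [->|/unit_imvec[p p1 [c _ ->]]] := eqVneq x 0.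
  by rewrite /quad_form mulmx0 mxE.
rewrite quad_formZ mulr_ge0 ?sqr_ge0 // /quad_form mulmxBr mulmxBl [leRHS]mxE [X in _ + X]mxE.
rewrite -!/(quad_form _ _) quad_form_scalar sphere2_imvec_sqr // mulr1 subr_ge0.
exact: quad_form_le_energy.
Qed.

(** On an eigenvector v the semidefinite form takes the value (E - l) |v|^2. *)
Lemma eigenvalue_le_energy l : eigenvalue A l -> l <= E.
Proof.
move=> /eigenvalueP[v vA v0]; have vT0 : v^T != 0 by rewrite trmx_eq0.
have := energy_sub_mx_psd v^T; rewrite /quad_form trmxK mulmxBr vA mul_mx_scalar -scalerBl.
rewrite -scalemxAl mxE pmulr_lge0 ?subr_ge0 //.
rewrite mxE (eq_bigr (fun a => v^T a 0 ^+ 2)) ?sum_sqr_gt0 // => a _.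
by rewrite mxE expr2.
Qed.

Hypothesis symA : A^T = A.

(** By the energy identity, membership in Hol_p means that X_p is a null vector of the form of E -
    A; semidefiniteness and symmetry put such a vector in the kernel. *)
Lemma Hol_eigenvector p : sphere2 p -> Hol p Omega f <-> A *m imvec p = E *: imvec p.
Proof.
move=> p1; rewrite Hol_energy //.
have X1 := sphere2_imvec_sqr p1; split=> [AX|AX].
  have /eqP : (E%:M - A) *m imvec p = 0.
    apply: psd_null_vector energy_sub_mx_psd _.
      by rewrite linearB /= tr_scalar_mx symA.
    rewrite /quad_form mulmxBr mulmxBl mxE [X in _ + X]mxE -!/(quad_form _ _).
    by rewrite quad_form_scalar X1 mulr1 AX subrr.
  by rewrite mulmxBl mul_scalar_mx subr_eq0 => /eqP.
rewrite /quad_form -mulmxA AX -scalemxAr mxE mxE.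
rewrite (eq_bigr (fun a => imvec p a 0 ^+ 2)) ?X1 ?mulr1 // => a _.
by rewrite mxE expr2.
Qed.

Lemma exists_Hol : (exists2 p, sphere2 p & Hol p Omega f) <-> eigenvalue A E.
Proof.
split=> [[p p1 /Hol_eigenvector AX]|].
  by apply/eigenvalue_sym => //; exists (imvec p); [exact: AX|exact: imvec_neq0].
move=> /(eigenvalue_sym _ symA)[x Ax /unit_imvec[p p1 [c c0 xE]]].
exists p => //; apply/Hol_eigenvector => //; apply: (scalerI c0).
by rewrite scalemxAr -xE Ax xE scalerA mulrC -scalerA.
Qed.

End Spectrum.

Theorem theorem2 (R : realType) (Omega : set (quaternion R))
    (f : quaternion R -> quaternion R)
    (Omega_neq0 : Omega !=set0) (Omega_open : open Omega)
    (Omega_connected : connected Omega) (Omega_bounded : bounded_set Omega)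
    (f_C1 : C1_closure Omega f) :
  let A := energy_mx Omega f in
  [/\ psi_regular Omega f <-> energy Omega f = \tr A,
      psi_regular Omega f ->
        [/\ A^T = A,
            exists l1 : R, largest_eigenvalue A l1,
            forall l1 : R, largest_eigenvalue A l1 -> l1 <= \tr A &
            \det (A - (\tr A)%:M) <= 0],
      psi_regular Omega f ->
        (forall l1 : R, largest_eigenvalue A l1 ->
          ((exists2 p, sphere2 p & Hol p Omega f) <->
           energy Omega f = \tr A /\ \tr A = l1)) /\
        ((exists2 p, sphere2 p & Hol p Omega f) <->
         \det (A - (\tr A)%:M) = 0) &
      forall l1 : R, largest_eigenvalue A l1 ->
        energy Omega f = \tr A -> \tr A = l1 ->
        forall p, sphere2 p ->
          (eigenvector A l1 (imvec p) <-> Hol p Omega f)].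
Proof.
have regE := psi_regular_energy Omega_open Omega_bounded f_C1.
have symA := energy_mx_sym Omega_open Omega_bounded f_C1.
have eig_le l := @eigenvalue_le_energy _ _ _ Omega_open Omega_bounded f_C1 l.
have exHol reg := exists_Hol Omega_open Omega_bounded f_C1 (symA reg).
split=> // [reg|reg|l1 [eig1 le_l1] Etr trl p p1].
- have Etr := regE.1 reg; split; first exact: symA.
  + exact: odd_largest_eigenvalue.
  + by move=> l1 [/eig_le + _]; rewrite Etr.
  (* In odd size 3, det(A - tr A) = -det(tr A - A). *)
  + rewrite -opprB -scaleN1r detZ -signr_odd expr1 mulN1r oppr_le0.
    by apply: eigenvalue_le_det_ge0 => l /eig_le; rewrite Etr.
- have Etr := regE.1 reg; split=> [l1 [eig1 le_l1]|].
    rewrite exHol //; split=> [eigE|[Etr' trl]]; last by rewrite Etr trl.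
    (* All eigenvalues are at most E = tr A, so once E is an eigenvalue it is the largest one. *)
    by split=> //; apply/le_anti; rewrite -Etr le_l1 // eig_le.
  by rewrite exHol // Etr eigenvalue_det; split=> /eqP.
(* The equality of energy and trace gives back psi-regularity, and with it the symmetry of A. *)
have reg := regE.2 Etr.
rewrite (Hol_eigenvector Omega_open Omega_bounded f_C1 (symA reg) p1) Etr trl.
by split=> [[]|AX] //; split=> //; exact: imvec_neq0.
Qed.
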